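(* For every positive integer $m$, \[ B_{2m+2}=-\frac{m+1}{2(2^{2m+2}-1)}\sum_{h=1}^{m}\frac{(2^{2h}-1)B_{2h}}{h}\binom{2m}{2h-2} \] and \[ B_{2m+2}=\frac{m+1}{2(2^{2m+2}-1)}\left(1-\sum_{h=1}^{m}\frac{(2^{2h}-1)B_{2h}}{h}\binom{2m+1}{2h-1}\right). \]
   Context: $B_s$ is the $s$th Bernoulli number (e.g. $B_2=1/6$, $B_4=-1/30$). *)

(* Defs.v *)
From mathcomp Require Import all_boot all_order all_algebra.
Set Implicit Arguments.
Unset Strict Implicit.
Unset Printing Implicit Defensive.
Import GRing.Theory.
Local Open Scope ring_scope.

(* [bernoulli_seq n] lists B_0, ..., B_(n-1), the coefficients of
   t / (e^t - 1) = \sum_s B_s t^s / s!, built by the standard recurrence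
   B_n = [n = 0] - (n + 1)^-1 * \sum_(k < n) 'C(n + 1, k) B_k. *)
Fixpoint bernoulli_seq (n : nat) : seq rat :=
  if n is m.+1 then
    let s := bernoulli_seq m in
    rcons s ((m == 0)%:R - (\sum_(k < m) 'C(m.+1, k)%:R * s`_k) / m.+1%:R)
  else [::].

Definition bernoulli (n : nat) : rat := (bernoulli_seq n.+1)`_n.

Lemma size_bernoulli_seq n : size (bernoulli_seq n) = n.
Proof. by elim: n => //= n IHn; rewrite size_rcons IHn. Qed.

Lemma nth_bernoulli_seq n k : (k < n)%N -> (bernoulli_seq n)`_k = bernoulli k.
Proof.
elim: n => // n IHn; rewrite ltnS leq_eqVlt => /predU1P [-> // | lt_kn].
by rewrite /= nth_rcons size_bernoulli_seq lt_kn IHn.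
Qed.

Lemma bernoulliE n :
  bernoulli n =
    (n == 0)%:R - (\sum_(k < n) 'C(n.+1, k)%:R * bernoulli k) / n.+1%:R.
Proof.
rewrite {1}/bernoulli /= nth_rcons size_bernoulli_seq ltnn eqxx.
by under eq_bigr => k _ do rewrite nth_bernoulli_seq //.
Qed.

Lemma sum_bernoulli n :
  \sum_(k < n.+1) 'C(n.+1, k)%:R * bernoulli k = (n == 0)%:R.
Proof.
have nz : n.+1%:R != 0 :> rat by rewrite Num.Theory.pnatr_eq0.
rewrite big_ord_recr /= binSn [bernoulli n]bernoulliE mulrBr mulrCA mulfV //.
by rewrite mulr1 addrC subrK; case: n {nz} => [|n] /=; rewrite ?mulr0 ?mulr1.
Qed.

Example bernoulli_0 : bernoulli 0 = 1.
Proof. by rewrite bernoulliE big_ord0 mul0r subr0. Qed.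

Example bernoulli_1 : bernoulli 1 = - (1 / 2%:R).
Proof. by rewrite bernoulliE !big_ord_recr big_ord0 /= bernoulli_0. Qed.

Example bernoulli_2 : bernoulli 2 = 1 / 6%:R.
Proof.
rewrite bernoulliE !big_ord_recr big_ord0 /= bernoulli_0 bernoulli_1.
exact/eqP.
Qed.

Example bernoulli_3 : bernoulli 3 = 0.
Proof.
rewrite bernoulliE !big_ord_recr big_ord0 /=.
rewrite bernoulli_0 bernoulli_1 bernoulli_2.
exact/eqP.
Qed.

Example bernoulli_4 : bernoulli 4 = - (1 / 30%:R).
Proof.
rewrite bernoulliE !big_ord_recr big_ord0 /=.
rewrite bernoulli_0 bernoulli_1 bernoulli_2 bernoulli_3.
exact/eqP.
Qed.

(* Main.v *)
(** Let [L] be the linear functional on polynomials with [L('X^k) = B_k].  The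
    Bernoulli recurrence says [L(p(X+1)) - L(p) = p'(0)], and a functional is
    determined by its values on the differences [p(X+1) - p].  Hence
    [L(p(2X+1)) + L(p(2X)) = 2 L(p)] and [L(p(-X)) = L(p(X+1))]; on monomials
    these give [\sum_k 'C(N, k) 2^k B_k = (2 - 2^N) B_N] and the vanishing of
    [B_N] for odd [N > 1].  The first turns into the recurrence
    [\sum_(k <= n) 'C(n, k) e_k + e_n = 0], [n > 0], for the coefficients [e_k]
    of [2 / (e^t + 1) = \sum_k e_k t^k / k!].  At [n = 2m + 1] it is the second
    identity, and by Pascal's rule subtracting it at [n = 2m] gives the first. *)

From HB Require Import structures.
Require Import Defs.
From mathcomp Require Import all_boot all_order all_algebra.
From mathcomp Require Import ring.
Set Implicit Arguments.
Unset Strict Implicit.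
Unset Printing Implicit Defensive.
Import GRing.Theory.
Local Open Scope ring_scope.

(** Strong induction on monomials: once [M] kills all ['X^i] with [i < n], invariance at ['X^(n.+1)]
    leaves only [n.+1 * M 'X^n = 0]. *)
Lemma scalar_shift_invariant_eq0 (R : numDomainType) (M : {scalar {poly R}}) :
  (forall p, M (p \Po ('X + 1)) = M p) -> forall p, M p = 0.
Proof.
move=> Minv.
have MX n : M 'X^n = 0.
  elim/ltn_ind: n => n IHn; have := Minv 'X^(n.+1).
  rewrite comp_Xn_poly addrC exprDn raddf_sum /= big_ord_recr /= binn mulr1n.
  rewrite expr1n mul1r -[RHS]add0r => /addIr.
  rewrite big_ord_recr big1 /= => [|i _]; last first.
    by rewrite expr1n mul1r raddfMn /= IHn ?mul0rn.
  rewrite add0r expr1n mul1r raddfMn /= binSn => /eqP.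
  by rewrite Num.Theory.mulrn_eq0 => /eqP.
move=> p; rewrite -[p]coefK poly_def raddf_sum big1 // => i _.
by rewrite /= linearZ /= MX mulr0.
Qed.

(** [L - M] is shift-invariant. Bare functions with linearity proofs let it apply directly to
    composite functionals. *)
Lemma scalar_eq_on_shift (R : numDomainType) (L M : {poly R} -> R) :
    scalar L -> scalar M ->
    (forall p, L (p \Po ('X + 1)) - L p = M (p \Po ('X + 1)) - M p) ->
  L =1 M.
Proof.
move=> Llin Mlin eqLM p; pose D q := L q - M q.
have Dlin : scalar D by move=> a q r; rewrite /D Llin Mlin /=; ring.
pose isD := GRing.isLinear.Build R {poly R} R *%R D Dlin.
apply/eqP; rewrite -subr_eq0; apply/eqP.
apply: (@scalar_shift_invariant_eq0 _ (HB.pack D isD)) => q /=.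
have := eqLM q; rewrite /D => /(canRL (subrK _)) ->; ring.
Qed.

Definition bernoulli_fun (p : {poly rat}) : rat :=
  \sum_(i < size p) p`_i * bernoulli i.

Lemma bernoulli_funE n (p : {poly rat}) :
  (size p <= n)%N -> bernoulli_fun p = \sum_(i < n) p`_i * bernoulli i.
Proof.
move=> le_pn; rewrite /bernoulli_fun (big_ord_widen n (fun i => p`_i * _ i)) //.
rewrite big_mkcond; apply: eq_bigr => i _; case: ltnP => // le_pi.
by rewrite nth_default ?mul0r.
Qed.

Lemma bernoulli_fun_scalar : scalar bernoulli_fun.
Proof.
move=> a p q; pose n := maxn (size (a *: p + q)) (maxn (size p) (size q)).
rewrite !(@bernoulli_funE n) ?leq_max ?leqnn ?orbT // mulr_sumr -big_split.
by apply: eq_bigr => i _ /=; rewrite coefD coefZ mulrDl mulrA.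
Qed.

HB.instance Definition _ :=
  GRing.isLinear.Build rat {poly rat} rat *%R bernoulli_fun bernoulli_fun_scalar.

Lemma bernoulli_funXn n : bernoulli_fun 'X^n = bernoulli n.
Proof.
rewrite /bernoulli_fun size_polyXn big_ord_recr big1 /= => [|i _].
  by rewrite coefXn eqxx mul1r add0r.
by rewrite coefXn ltn_eqF ?mul0r.
Qed.

Lemma bernoulli_fun_XD1n n :
  bernoulli_fun (('X + 1) ^+ n) = \sum_(k < n.+1) 'C(n, k)%:R * bernoulli k.
Proof.
rewrite addrC exprDn raddf_sum; apply: eq_bigr => i _ /=.
by rewrite expr1n mul1r raddfMn /= bernoulli_funXn mulr_natl.
Qed.

Lemma sum_binomial_bernoulli n :
  \sum_(k < n.+1) 'C(n, k)%:R * bernoulli k = bernoulli n + (n == 1)%:R.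
Proof.
case: n => [|n]; first by rewrite big_ord1 bin0 mul1r addr0.
by rewrite big_ord_recr /= sum_bernoulli binn mul1r addrC.
Qed.

(** On ['X^i] the increment is [[i = 1]], which is the derivative of ['X^i] at 0. *)
Lemma bernoulli_fun_shift p :
  bernoulli_fun (p \Po ('X + 1)) = bernoulli_fun p + p^`().[0].
Proof.
rewrite -[p]coefK poly_def !raddf_sum /= horner_sum -big_split; apply: eq_bigr => i _ /=.
rewrite !linearZ /= comp_Xn_poly bernoulli_fun_XD1n bernoulli_funXn.
rewrite sum_binomial_bernoulli hornerZ derivXn hornerMn hornerXn expr0n.
by case: (nat_of_ord i) => [|[|k]]; rewrite /= ?mul0rn ?mulr0n; ring.
Qed.

Lemma comp_poly_shift (R : comNzRingType) (p q : {poly R}) :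
  (p \Po ('X + 1)) \Po q = p \Po (q + 1).
Proof. by rewrite -comp_polyA comp_polyD comp_polyX comp_polyC. Qed.

(** Replacing [p] by [p(X+1)] turns [p(2X)] into [p(2X+1)], and [p(2X+1)] into the shift of [p(2X)].
    The left side thus grows by [(p(2X))'(0) = 2 p'(0)], as does the right. *)
Lemma bernoulli_fun_double p :
  bernoulli_fun (p \Po (2 *: 'X + 1)) + bernoulli_fun (p \Po (2 *: 'X)) =
  2 * bernoulli_fun p.
Proof.
move: p; apply: scalar_eq_on_shift => [a p q | a p q | p];
  rewrite ?linearP /=; try ring.
have -> :
    (p \Po ('X + 1)) \Po (2 *: 'X + 1) = (p \Po (2 *: 'X)) \Po ('X + 1).
  rewrite comp_poly_shift -comp_polyA comp_polyZ comp_polyX scalerDr -addrA.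
  by rewrite !scaler_nat.
rewrite comp_poly_shift !bernoulli_fun_shift deriv_comp derivZ derivX.
rewrite hornerM horner_comp !hornerZ hornerX hornerC mulr0 mulr1; ring.
Qed.

(** [p(-X)] is the shift of [p(1-X)], so both sides grow by [p'(1)] when [p] is shifted. *)
Lemma bernoulli_fun_opp p :
  bernoulli_fun (p \Po - 'X) = bernoulli_fun (p \Po ('X + 1)).
Proof.
move: p; apply: scalar_eq_on_shift => [a p q | a p q | p];
  rewrite ?linearP /=; try ring.
have -> : p \Po - 'X = (p \Po (- 'X + 1)) \Po ('X + 1).
  rewrite -comp_polyA comp_polyD raddfN /= comp_polyX comp_polyC.
  by rewrite opprD subrK.
rewrite comp_poly_shift !bernoulli_fun_shift !deriv_comp !derivE !hornerM.
rewrite !horner_comp !hornerE; ring.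
Qed.

Lemma sum_binomial_exp2_bernoulli n :
  \sum_(k < n.+1) 'C(n, k)%:R * 2 ^+ k * bernoulli k =
  (2 - 2 ^+ n) * bernoulli n.
Proof.
have := bernoulli_fun_double 'X^n.
rewrite !comp_Xn_poly exprZn linearZ /= bernoulli_funXn.
move=> /(canRL (addrK _)); rewrite -mulrBl => <-.
rewrite addrC exprDn raddf_sum; apply: eq_bigr => i _ /=.
rewrite expr1n mul1r raddfMn /= exprZn linearZ /= bernoulli_funXn.
by rewrite -mulrA mulr_natl.
Qed.

Lemma bernoulli_odd n : odd n -> (1 < n)%N -> bernoulli n = 0.
Proof.
move=> odd_n lt1n; have := bernoulli_fun_opp 'X^n.
rewrite !comp_Xn_poly bernoulli_fun_XD1n sum_binomial_bernoulli.
rewrite exprNn -signr_odd odd_n expr1 mulN1r raddfN /= bernoulli_funXn.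
rewrite gtn_eqF // addr0 => /esym/eqP; rewrite -subr_eq0 opprK -mulr2n.
by rewrite Num.Theory.mulrn_eq0 => /eqP.
Qed.

(* The value at 0 of the [k]th Euler polynomial, the coefficient of [t^k / k!]
   in [2 / (e^t + 1)]. *)
Definition euler_poly0 (k : nat) : rat :=
  2 * (1 - 2 ^+ k.+1) * bernoulli k.+1 / k.+1%:R.

Lemma euler_poly0_even k : (0 < k)%N -> ~~ odd k -> euler_poly0 k = 0.
Proof. by move=> k0 ek; rewrite /euler_poly0 bernoulli_odd ?mulr0 ?mul0r. Qed.

Lemma sum_binomial_euler_poly0 n : (0 < n)%N ->
  \sum_(k < n.+1) 'C(n, k)%:R * euler_poly0 k = - euler_poly0 n.
Proof.
move=> n_gt0; have nz k : k.+1%:R != 0 :> rat by rewrite Num.Theory.pnatr_eq0.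
apply: (mulfI (nz n)).
(* Absorption, [(n+1) 'C(n, k) = (k+1) 'C(n+1, k+1)], raises the index by one; the new term [k = 0]
   vanishes since [1 - 2^0 = 0]. *)
transitivity (\sum_(k < n.+2)
    ('C(n.+1, k)%:R * bernoulli k - 'C(n.+1, k)%:R * 2 ^+ k * bernoulli k) * 2).
  rewrite [RHS]big_ord_recl expr0 mulr1 subrr mul0r add0r mulr_sumr.
  apply: eq_bigr => k _; rewrite /euler_poly0 lift0 mulrA -natrM.
  rewrite mul_bin_diag natrM; by field; rewrite nat1r nz.
rewrite -mulr_suml sumrB sum_binomial_exp2_bernoulli sum_binomial_bernoulli.
rewrite eqSS gtn_eqF // addr0 /euler_poly0; by field; rewrite nat1r nz.
Qed.

(** The leading 1 is [euler_poly0 0]; the other even-index terms vanish. *)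
Lemma sum_binomial_euler_poly0_odd N m :
  \sum_(k < m.*2.+1) 'C(N, k)%:R * euler_poly0 k =
  1 + \sum_(h < m) 'C(N, h.*2.+1)%:R * euler_poly0 h.*2.+1.
Proof.
elim: m => [|m IHm].
  rewrite big_ord1 big_ord0 bin0 /euler_poly0 bernoulli_1.
  by apply/eqP.
rewrite doubleS 2!big_ord_recr [in RHS]big_ord_recr /= IHm.
by rewrite (@euler_poly0_even m.*2.+2) /= ?odd_double // mulr0 addr0 addrA.
Qed.

Theorem corollary2p6 (m : nat) (hm : (0 < m)%N) :
  bernoulli (2 * m + 2) =
    - (m.+1%:R / (2 * (2 ^+ (2 * m + 2) - 1))) *
      \sum_(1 <= h < m.+1)
        (2 ^+ (2 * h) - 1) * bernoulli (2 * h) / h%:R * 'C(2 * m, 2 * h - 2)%:R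
  /\
  bernoulli (2 * m + 2) =
    m.+1%:R / (2 * (2 ^+ (2 * m + 2) - 1)) *
      (1 - \sum_(1 <= h < m.+1)
        (2 ^+ (2 * h) - 1) * bernoulli (2 * h) / h%:R *
          'C(2 * m + 1, 2 * h - 1)%:R).
Proof.
pose e := euler_poly0.
have nz k : k.+1%:R != 0 :> rat by rewrite Num.Theory.pnatr_eq0.
have eE h :
    (2 ^+ (2 * h.+1) - 1) * bernoulli (2 * h.+1) / h.+1%:R = - e h.*2.+1.
  rewrite /e /euler_poly0 -doubleS -mul2n natrM.
  by field; rewrite nat1r nz.
(* At [n = 2m+1] the top term of the recurrence joins the right side, hence the factor 2. *)
have S1 :
    \sum_(h < m) 'C(m.*2.+1, h.*2.+1)%:R * e h.*2.+1 = - 1 - 2 * e m.*2.+1.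
  have := @sum_binomial_euler_poly0 m.*2.+1 isT.
  rewrite big_ord_recr /= binn mul1r sum_binomial_euler_poly0_odd -/e => E.
  apply/eqP; rewrite -subr_eq0; apply/eqP.
  by rewrite -[RHS](subrr (- e m.*2.+1)) -{1}E; ring.
(* At [n = 2m] the right side [- e (2m)] is zero, as [2m] is even and positive. *)
have S0 : \sum_(h < m) 'C(m.*2, h.*2.+1)%:R * e h.*2.+1 = - 1.
  have := @sum_binomial_euler_poly0 m.*2; rewrite double_gt0 => /(_ hm).
  rewrite sum_binomial_euler_poly0_odd (@euler_poly0_even m.*2) ?double_gt0 //.
    by rewrite oppr0 => /(canRL (addKr _)); rewrite addr0.
  by rewrite odd_double.
have B_e : bernoulli (2 * m + 2) =
    m.+1%:R / (2 * (2 ^+ (2 * m + 2) - 1)) * (- 2 * e m.*2.+1).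
  have pow_neq1 : 2 ^+ (2 * m.+1) - 1 != 0 :> rat.
    by rewrite subr_eq0 Num.Theory.pexprn_eq1.
  rewrite addnC -mulnS mulNr -mulrN -eE.
  by field; rewrite pow_neq1 nat1r nz.
split; rewrite B_e; rewrite big_add1 big_mkord.
  rewrite [RHS]mulNr -[RHS]mulrN; congr (_ * _).
  (* Pascal's rule for ['C(2m, 2h)], with [h] now counted from 0; the sum becomes the value in [S0]
     minus that in [S1], namely [2 e (2m+1)]. *)
  rewrite (eq_bigr (fun h : 'I_m => 'C(m.*2, h.*2.+1)%:R * e h.*2.+1 -
                     'C(m.*2.+1, h.*2.+1)%:R * e h.*2.+1)) => [|h _].
    by rewrite sumrB S0 S1; ring.
  rewrite eE !mul2n doubleS subn2 /= binS natrD; ring.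
congr (_ * _).
rewrite (eq_bigr (fun h : 'I_m =>
  - ('C(m.*2.+1, h.*2.+1)%:R * e h.*2.+1))) => [|h _].
  by rewrite sumrN S1; ring.
rewrite eE !mul2n addn1 doubleS subn1 /=; ring.
Qed.
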